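(* Let $(X,d)$ be a metric space. Then a non-empty subset $A$ of $X$ is Bourbaki quasi-precompact in $X$ if and only if every sequence in $A$ has a subsequence which is Bourbaki quasi-Cauchy in $X$.
   Context: Let $(X,d)$ be a metric space. $B_\varepsilon(x)$ is the open ball with centre $x$ and radius $\varepsilon>0$; for $A\subseteq X$, $A^{\varepsilon}=\bigcup_{x\in A}B_\varepsilon(x)$. Put $B^1_\varepsilon(x)=B_\varepsilon(x)$, $B^n_\varepsilon(x)=(B^{n-1}_\varepsilon(x))^{\varepsilon}$ for $n\ge 2$, and $B^\infty_\varepsilon(x)=\bigcup_{n\in\mathbb{N}}B^n_\varepsilon(x)$ (the set of points that can be joined to $x$ by a finite chain in $X$ whose consecutive points are at distance $<\varepsilon$). A subset $B\subseteq X$ is Bourbaki quasi-precompact in $X$ if for every $\varepsilon>0$ there are finitely many points $p_1,\dots,p_k\in X$ with $B\subseteq\bigcup_{i=1}^k B^\infty_\varepsilon(p_i)$. A sequence $(x_n)$ is Bourbaki quasi-Cauchy in $X$ if for every $\varepsilon>0$ there exist $n_0\in\mathbb{N}$ and $p\in X$ such that $x_n\in B^\infty_\varepsilon(p)$ for every $n\ge n_0$. *)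

(* Defs.v *)
From HB Require Import structures.
From mathcomp Require Import all_boot all_order all_algebra.
From mathcomp Require Import all_classical all_reals.
From mathcomp Require Import topology sequences.

Set Implicit Arguments.
Unset Strict Implicit.
Unset Printing Implicit Defensive.

Import Order.TTheory GRing.Theory Num.Theory.

Local Open Scope classical_set_scope.
Local Open Scope ring_scope.

Definition enlargement (R : realType) (X : metricType R) (e : R) (A : set X) :
  set X := \bigcup_(x in A) ball x e.

(* B^n_e(x) for n >= 1; the value at n = 0 is a dummy, excluded in [ball_infty] *)
Definition ball_iter (R : realType) (X : metricType R) (e : R) (n : nat)
  (x : X) : set X := iter n.-1 (enlargement e) (ball x e).

Definition ball_infty (R : realType) (X : metricType R) (e : R) (x : X) :
  set X := \bigcup_(n in [set n | (0 < n)%N]) ball_iter e n x.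

Definition bourbaki_quasi_precompact (R : realType) (X : metricType R)
  (B : set X) : Prop :=
  forall e : R, 0 < e ->
    exists2 F : set X, finite_set F & B `<=` \bigcup_(p in F) ball_infty e p.

Definition bourbaki_quasi_cauchy (R : realType) (X : metricType R)
  (u : nat -> X) : Prop :=
  forall e : R, 0 < e ->
    exists (n0 : nat) (p : X), forall n, (n0 <= n)%N -> ball_infty e p (u n).

(* Main.v *)
Require Import Defs.
From HB Require Import structures.
From mathcomp Require Import all_boot all_order all_algebra.
From mathcomp Require Import all_classical all_reals.
From mathcomp Require Import topology sequences.

Set Implicit Arguments.
Unset Strict Implicit.
Unset Printing Implicit Defensive.

Import Order.TTheory GRing.Theory Num.Theory.

Local Open Scope classical_set_scope.
Local Open Scope ring_scope.

(** Being joined by an [e]-chain is an equivalence relation, finer for smaller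
    [e], and precompactness says that [A] meets finitely many classes for each
    [e].  If so, the pigeonhole principle yields nested infinite index sets
    whose [k]-th term is sent by the sequence into a single class for
    [e = 1/(k+1)], and a diagonal subsequence is quasi-Cauchy.  Otherwise a
    greedy choice for some [e] gives a sequence in pairwise distinct classes,
    no subsequence of which is quasi-Cauchy. *)

Section ChainClasses.
Variables (R : realType) (X : metricType R).
Implicit Types (e : R) (x y z : X).

Lemma ball_ball_infty e x y : ball x e y -> ball_infty e x y.
Proof. by move=> xy; exists 1%N. Qed.

Lemma ball_infty_step e x y z :
  ball_infty e x y -> ball y e z -> ball_infty e x z.
(* The index 0 is ruled out by the side condition in [ball_infty]. The new step is one more
   [enlargement], taken at [y]. *)
Proof. by case=> -[//|n] _ xy yz; exists n.+2 => //; exists y. Qed.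

(** Induction along a chain from [x], so that the lemmas below need not handle the number of
    iterations. *)
Lemma ball_infty_ind e x (P : X -> Prop) :
  (forall y, ball x e y -> P y) -> (forall y z, P y -> ball y e z -> P z) ->
  forall y, ball_infty e x y -> P y.
Proof.
move=> P1 PS y [[//|n] _]; rewrite /ball_iter /=.
elim: n y => [|n IHn] y /=; first exact: P1.
by case=> w /IHn Pw; apply: PS.
Qed.

Lemma ball_infty_trans e x y z :
  ball_infty e x y -> ball_infty e y z -> ball_infty e x z.
Proof.
by move=> xy; move: z; apply: ball_infty_ind => [z|z w]; apply: ball_infty_step.
Qed.

Lemma ball_infty_sym e x y : ball_infty e x y -> ball_infty e y x.
Proof.
move: y; apply: ball_infty_ind => [y /ball_sym|y z yx /ball_sym zy].
  exact: ball_ball_infty.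
exact: ball_infty_trans (ball_ball_infty zy) yx.
Qed.

Lemma ball_infty_le e1 e2 x :
  e1 <= e2 -> ball_infty e1 x `<=` ball_infty e2 x.
Proof.
move=> e12; apply: ball_infty_ind => [y|y z xy] /(le_ball e12).
  exact: ball_ball_infty.
exact: ball_infty_step.
Qed.

End ChainClasses.

Lemma infinite_nat_unbounded (S : set nat) (N : nat) :
  infinite_set S -> exists2 n, S n & (N < n)%N.
Proof.
move=> Sinf.
have /infinite_setN0[n [Sn Nn]] : infinite_set (S `\` `I_N.+1).
  exact: infinite_setD.
by exists n => //; rewrite ltnNge; apply/negP.
Qed.

Lemma infinite_pigeonhole (I T : Type) (S : set I) (F : set T)
    (D : T -> set I) :
  infinite_set S -> finite_set F -> S `<=` \bigcup_(p in F) D p ->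
  exists2 p, F p & infinite_set (S `&` D p).
Proof.
move=> Sinf Ffin SD; apply: contrapT => noinf; apply: Sinf.
apply: (@sub_finite_set _ _ (\bigcup_(p in F) (S `&` D p))).
  by move=> i Si; have [p Fp Dp] := SD i Si; exists p.
apply: bigcup_finite => // p Fp; apply: contrapT => Dp.
by apply: noinf; exists p.
Qed.

(** Refining repeatedly from [setT] gives nested infinite sets [S k] with [P k (S k)]. Since [phi n]
    is picked in [S n], nestedness puts it in every [S k] with [k <= n]. *)
Lemma diagonal_seq (P : nat -> set nat -> Prop) :
  (forall k S, infinite_set S ->
     exists S', [/\ infinite_set S', S' `<=` S & P k S']) ->
  exists2 phi : nat -> nat, increasing_seq phi &
    forall k, exists2 S, P k S & forall n, (k <= n)%N -> S (phi n).
Proof.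
move=> Pnext.
have /choice[next nextP] (kS : nat * set nat) : exists S', infinite_set kS.2 ->
    [/\ infinite_set S', S' `<=` kS.2 & P kS.1 S'].
  (* For a finite set the requirement is vacuous; [set0] only makes [next] total. *)
  have [Sinf|Sfin] := pselect (infinite_set kS.2); last by exists set0.
  by have [S' S'P] := Pnext kS.1 kS.2 Sinf; exists S'.
pose S := fix S k := next (k, if k is k'.+1 then S k' else setT).
have Sinf k : infinite_set (S k).
  elim: k => [|k IHk] /=.
    by case: (nextP (0%N, setT)) => //=; exact: infinite_nat.
  by case: (nextP (k.+1, S k)).
have PS k : P k (S k).
  case: k => [|k]; last by case: (nextP (k.+1, S k)) => //; exact: Sinf.
  by case: (nextP (0%N, setT)) => //=; exact: infinite_nat.
have S_sub k n : (k <= n)%N -> S n `<=` S k.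
  move=> /subnK <-; elim: (n - k)%N => // m IHm.
  case: (nextP ((m + k).+1, S (m + k)%N)) => [|_ sub _]; first exact: Sinf.
  exact: subset_trans sub IHm.
have /choice[pick pickP] (kN : nat * nat) : exists n, S kN.1 n /\ (kN.2 < n)%N.
  by have [n] := infinite_nat_unbounded kN.2 (Sinf kN.1); exists n.
(* Picking beyond the previous value makes [phi] strictly increasing; the bound 0 at the start is
   arbitrary. *)
pose phi := fix phi k := pick (k, if k is k'.+1 then phi k' else 0%N).
exists phi; first by apply/increasing_seqP => k; case: (pickP (k.+1, phi k)).
move=> k; exists (S k) => // n kn; apply: (S_sub _ _ kn).
by case: n {kn} => [|n]; [case: (pickP (0%N, 0%N))|case: (pickP (n.+1, phi n))].
Qed.

Lemma greedy_seq (T : eqType) (A : set T) (r : T -> T -> Prop) :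
  (forall s : seq T, exists2 a, A a & forall p, p \in s -> r p a) ->
  exists2 u : nat -> T, forall n, A (u n) &
    forall i j, (i < j)%N -> r (u i) (u j).
Proof.
move=> next; have /choice[f fP] (s : seq T) :
    exists a, A a /\ forall p, p \in s -> r p a.
  by have [a Aa ra] := next s; exists a.
(* [s n] lists the first [n] chosen points, so each choice is made against all earlier ones. *)
pose s := fix s n := if n is m.+1 then f (s m) :: s m else [::].
exists (f \o s) => [n|i j ij]; first by case: (fP (s n)).
have [_] := fP (s j); apply.
elim: j ij => // j IHj; rewrite ltnS leq_eqVlt inE => /orP[/eqP ->|/IHj ->].
  by rewrite eqxx.
by rewrite orbT.
Qed.

Theorem theorem2p2 (R : realType) (X : metricType R) (A : set X)
    (hA : A !=set0) :
  bourbaki_quasi_precompact A <->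
  (forall u : nat -> X, (forall n, A (u n)) ->
    exists2 phi : nat -> nat,
      increasing_seq phi & bourbaki_quasi_cauchy (u \o phi)).
Proof.
split=> [Apre u uA|Asub e e0].
  pose P k (S : set nat) :=
    exists p, forall n, S n -> ball_infty k.+1%:R^-1 p (u n).
  have [k S Sinf|phi phi_incr phiP] := @diagonal_seq P.
    have k0 : 0 < k.+1%:R^-1 :> R by rewrite invr_gt0.
    have [F Ffin AF] := Apre _ k0.
    have [n _|p _ Spinf] := @infinite_pigeonhole _ _ S F
      (fun p => u @^-1` ball_infty k.+1%:R^-1 p) Sinf Ffin.
      by have [p Fp up] := AF _ (uA n); exists p.
    exists (S `&` u @^-1` ball_infty k.+1%:R^-1 p).
    by split=> //; exists p => n [].
  exists phi => // e e0.
  have [k ke] : exists k : nat, k.+1%:R^-1 <= e.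
    (* Archimedean choice: [k.+1] exceeds [e^-1]. *)
    exists (Num.truncn e^-1); rewrite invf_ple ?posrE //.
    by apply/ltW/truncnS_gt.
  have [S [p Sp] Sphi] := phiP k.
  exists k, p => n kn; apply: (ball_infty_le ke).
  exact/Sp/Sphi.
apply: contrapT => ncover.
have [s|u uA u_far] :=
    @greedy_seq X A (fun p a => ~ ball_infty e p a).
  (* If no point of [A] avoided the classes of the points in [s], then [s] would be a finite cover
     for [e]. *)
  apply: contrapT => nochoice; apply: ncover.
  exists [set` s]; first exact: finite_seq.
  move=> a Aa; apply: contrapT => nas; apply: nochoice; exists a => // p ps pa.
  by apply: nas; exists p.
have [phi /increasing_seqP phi_incr ucauchy] := Asub u uA.
have [n0 [p up]] := ucauchy e e0.
(* Two consecutive terms of the subsequence are joined through [p], although [u_far] separates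
   them. *)
apply: (u_far _ _ (phi_incr n0)).
exact: ball_infty_trans (ball_infty_sym (up n0 _)) (up n0.+1 _).
Qed.
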